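(* Let $f_0:\mathbb{R}^n\to\mathbb{R}$ be locally Lipschitz continuous, let $X\subset\mathbb{R}^n$ be nonempty and compact, and for $k=1,\dots,s$ and $i=1,\dots,r_k$ let $f_{ik}:\mathbb{R}^{m_k}\times\mathbb{R}^n\to\mathbb{R}$ be continuously differentiable. Let $m=\sum_{k=1}^s m_k$, and let $\bar u=(\bar u^1,\dots,\bar u^s)\in\mathbb{R}^m$ with $\bar u^k\in\mathbb{R}^{m_k}$. For each $k$ let $\|\cdot\|_{(k)}$ be a norm on $\mathbb{R}^{m_k}$. For $u=(u^1,\dots,u^s)\in\mathbb{R}^m$ and $\delta\in\mathbb{R}$ define \[ U(u,\delta)=\Big\{(v^1,\dots,v^s)\in\mathbb{R}^m ~\Big|~ \max_{k=1,\dots,s}\|v^k-u^k\|_{(k)}\le|\delta|\Big\} \] and the min-value function $p:\mathbb{R}^{m+1}\to[-\infty,\infty]$, \[ p(u,\delta)=\inf_{x\in X}\ \sup_{v\in U(u,\delta)}\ f_0(x)+\sum_{k=1}^s\max_{i=1,\dots,r_k} f_{ik}(v^k,x). \] Let $M$ be the set of minimizers of the problem $\min_{x\in X} f_0(x)+\sum_{k=1}^s\max_{i=1,\dots,r_k} f_{ik}(\bar u^k,x)$, and for $x\in\mathbb{R}^n$ and $k=1,\dots,s$ let \[ I_k(x)=\Big\{i ~\Big|~ f_{ik}(\bar u^k,x)=\max_{j=1,\dots,r_k} f_{jk}(\bar u^k,x)\Big\}. \] Then $p$ is locally Lipschitz continuous at $(\bar u,0)$ with local Lipschitz modulus \[ \operatorname{lip}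 p(\bar u,0)\le \max_{\bar x\in M}\sum_{k=1}^s\sum_{i\in I_k(\bar x)}\ \max_{\|w_i^k\|_{(k)}\le 1}\sqrt{\big\|\nabla_1 f_{ik}(\bar u^k,\bar x)\big\|_2^2+\big(\langle\nabla_1 f_{ik}(\bar u^k,\bar x),w_i^k\rangle\big)^2}, \] where the right-hand side simplifies to $\sqrt{2}\max_{\bar x\in M}\sum_{k=1}^s\sum_{i\in I_k(\bar x)}\|\nabla_1 f_{ik}(\bar u^k,\bar x)\|_2$ when $\|\cdot\|_{(k)}=\|\cdot\|_2$ for all $k$. Moreover, for each subgradient $(g,\gamma)\in\partial p(\bar u,0)$ (with $g\in\mathbb{R}^m$, $\gamma\in\mathbb{R}$), there exist a minimizer $\bar x\in M$ and multipliers $\{w_i^k\in\mathbb{R}^{m_k},\ y_i^k\ge 0:\ i\in I_k(\bar x),\ k=1,\dots,s\}$ such that \[ g=\sum_{k=1}^s\sum_{i\in I_k(\bar x)} y_i^k\,\nabla_1 f_{ik}(\bar u^k,\bar x),\qquad \gamma=\sum_{k=1}^s\sum_{i\in I_k(\bar x)} y_i^k\,\big\langle\nabla_1 f_{ik}(\bar u^k,\bar x),w_i^k\big\rangle, \] where for all $k$, $\|w_i^k\|_{(k)}\le 1$ and $\sum_{i\in I_k(\bar x)} y_i^k=1$.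
   Context: $\nabla_1 f_{ik}(u^k,x)$ denotes the gradient of $f_{ik}(\cdot,x)$ at $u^k$ for fixed $x$. A function $f:\mathbb{R}^N\to[-\infty,\infty]$ is locally Lipschitz continuous at $\bar z$ if it is real-valued on a neighborhood of $\bar z$ and there exist $\kappa\in[0,\infty)$ and $\epsilon>0$ with $|f(z)-f(z')|\le\kappa\|z-z'\|_2$ whenever $\|z-\bar z\|_2\le\epsilon$, $\|z'-\bar z\|_2\le\epsilon$; it is locally Lipschitz continuous if this holds at every point. The local Lipschitz modulus is $\operatorname{lip} f(\bar z)=\limsup_{z,z'\to\bar z,\ z\ne z'}|f(z)-f(z')|/\|z-z'\|_2$. For $f$ finite at $\bar z$, $\partial f(\bar z)$ denotes the set of (general, i.e. Mordukhovich/limiting) subgradients of $f$ at $\bar z$. *)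

(* Defs.v *)
From HB Require Import structures.
From mathcomp Require Import all_boot all_order all_algebra.
From mathcomp Require Import all_classical all_reals all_analysis.
Set Implicit Arguments. Unset Strict Implicit. Unset Printing Implicit Defensive.
Import Order.TTheory GRing.Theory Num.Theory.
Import numFieldNormedType.Exports.
Local Open Scope classical_set_scope.
Local Open Scope ring_scope.

Section Defs.
Variable R : realType.

Definition dot (N : nat) (x y : 'rV[R]_N) : R := \sum_(i < N) x 0 i * y 0 i.
Definition norm2 (N : nat) (x : 'rV[R]_N) : R := Num.sqrt (dot x x).

Definition is_norm (N' : nat) (nrm : 'rV[R]_N' -> R) : Prop :=
  [/\ forall x, nrm x = 0 -> x = 0,
      forall (a : R) x, nrm (a *: x) = `|a| * nrm x
    & forall x y, nrm (x + y) <= nrm x + nrm y].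

(* max_{i < N} F i (N > 0); arbitrary value 0 when N = 0 *)
Definition fmax (N : nat) : ('I_N -> R) -> R :=
  match N return ('I_N -> R) -> R with
  | 0 => fun _ => 0
  | N'.+1 => fun F => \big[Num.max/F ord0]_(i < N'.+1) F i
  end.

Definition loc_lip_at (N : nat) (f : 'rV[R]_N -> \bar R) (zb : 'rV[R]_N) : Prop :=
  exists kappa : R, 0 <= kappa /\ exists eps : R, 0 < eps /\
    forall z z', norm2 (z - zb) <= eps -> norm2 (z' - zb) <= eps ->
      f z \is a fin_num /\ `|fine (f z) - fine (f z')| <= kappa * norm2 (z - z').

Definition loc_lip (N : nat) (f : 'rV[R]_N -> \bar R) : Prop :=
  forall z, loc_lip_at f z.

Definition lip_mod (N : nat) (f : 'rV[R]_N -> \bar R) (zb : 'rV[R]_N) : \bar R :=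
  ereal_inf [set ereal_sup [set q | exists z z',
      [/\ z != z', norm2 (z - zb) < eps, norm2 (z' - zb) < eps &
          q = (`|f z - f z'| * ((norm2 (z - z'))^-1)%:E)%E]]
    | eps in [set e : R | 0 < e]].

Definition reg_subgrad (N : nat) (f : 'rV[R]_N -> \bar R) (z v : 'rV[R]_N) : Prop :=
  f z \is a fin_num /\
  forall eps : R, 0 < eps -> exists del : R, 0 < del /\
    forall z', norm2 (z' - z) < del ->
      ((fine (f z) + dot v (z' - z) - eps * norm2 (z' - z))%:E <= f z')%E.

Definition subgrad (N : nat) (f : 'rV[R]_N -> \bar R) (zb v : 'rV[R]_N) : Prop :=
  f zb \is a fin_num /\
  exists (zs vs : nat -> 'rV[R]_N),
    [/\ zs n @[n --> \oo] --> zb,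
        f (zs n) @[n --> \oo] --> f zb,
        (forall n, reg_subgrad f (zs n) (vs n))
      & vs n @[n --> \oo] --> v].

Definition C1 (a b : nat) (F : 'rV[R]_a * 'rV[R]_b -> R) : Prop :=
  (forall z, differentiable F z) /\ (forall w, continuous (fun z => 'd F z w)).

Definition grad1 (a b : nat) (F : 'rV[R]_a * 'rV[R]_b -> R) (u : 'rV[R]_a)
  (x : 'rV[R]_b) : 'rV[R]_a :=
  \row_(j < a) ('d F (u, x) (delta_mx 0 j, 0)).

End Defs.

(* Main.v *)
(* Write phi(z, x) for the inner supremum at z = (u, delta). Balls of a norm are
   symmetric, so every v in U(u, delta) is u + delta w with block norms of w at
   most 1, and w can be kept fixed when z moves. The mean value theorem then
   bounds phi(z', x) - phi(z, x), for x near xb and z, z' near (ub, 0), by the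
   largest <slope, z' - z> + eps |z' - z|, where a slope picks for each k an
   active piece i and has entries g = grad f_ik(ub^k, xb) and +c or -c, with
   c = max_{|w| <= 1} <g, w>. Since p(z') - p(z) <= phi(z', x) - phi(z, x) when
   x is a minimizer at z, and minimizers at z near (ub, 0) are near M, covering
   the compact X gives the Lipschitz bounds. If a subgradient v were outside the
   convex hull of the slopes at every xb in M, then for each xb a direction d
   separating v from the hull would make the regular subgradients approximating
   v incompatible with a minimizer near xb; covering X again, no minimizer would
   remain. A convex combination of slopes is regrouped by pieces into
   the multipliers y and w. *)

Require Import Defs.
From HB Require Import structures.
From mathcomp Require Import all_boot all_order all_algebra.
From mathcomp Require Import all_classical all_reals all_analysis.
From mathcomp Require Import ring lra.
Set Implicit Arguments.
Unset Strict Implicit.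
Unset Printing Implicit Defensive.
Import Order.TTheory GRing.Theory Num.Theory.
Import numFieldNormedType.Exports.
Local Open Scope classical_set_scope.
Local Open Scope ring_scope.

(** * Euclidean inner product and norm, compared with the sup norm *)

Section Euclidean.
Variables (R : realType) (N : nat).
Implicit Types x y z : 'rV[R]_N.

Lemma dotC x y : dot x y = dot y x.
Proof. by rewrite /dot; apply: eq_bigr => i _; rewrite mulrC. Qed.

Lemma dotDl x y z : dot (x + y) z = dot x z + dot y z.
Proof.
by rewrite /dot -big_split; apply: eq_bigr => i _; rewrite mxE mulrDl.
Qed.

Lemma dotZl (a : R) x y : dot (a *: x) y = a * dot x y.
Proof.
by rewrite /dot mulr_sumr; apply: eq_bigr => i _; rewrite mxE mulrA.
Qed.

Lemma dotNl x y : dot (- x) y = - dot x y.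
Proof. by rewrite -scaleN1r dotZl mulN1r. Qed.

Lemma dotDr x y z : dot x (y + z) = dot x y + dot x z.
Proof. by rewrite dotC dotDl !(dotC x). Qed.

Lemma dotZr (a : R) x y : dot x (a *: y) = a * dot x y.
Proof. by rewrite dotC dotZl dotC. Qed.

Lemma dotNr x y : dot x (- y) = - dot x y.
Proof. by rewrite dotC dotNl dotC. Qed.

Lemma dot_ge0 x : 0 <= dot x x.
Proof. by apply: sumr_ge0 => i _; rewrite -expr2 sqr_ge0. Qed.

Lemma norm2_ge0 x : 0 <= norm2 x.
Proof. exact: sqrtr_ge0. Qed.

Lemma sqr_norm2 x : norm2 x ^+ 2 = dot x x.
Proof. by rewrite sqr_sqrtr // dot_ge0. Qed.

Lemma norm2Z (a : R) x : norm2 (a *: x) = `|a| * norm2 x.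
Proof.
by rewrite /norm2 dotZl dotZr mulrA -expr2 sqrtrM ?sqr_ge0// sqrtr_sqr.
Qed.

Lemma norm2N x : norm2 (- x) = norm2 x.
Proof. by rewrite -scaleN1r norm2Z normrN1 mul1r. Qed.

Lemma norm2_distC x y : norm2 (x - y) = norm2 (y - x).
Proof. by rewrite -norm2N opprB. Qed.

Lemma norm2_eq0 x : (norm2 x == 0) = (x == 0).
Proof.
apply/idP/eqP => [|->]; last first.
  by rewrite /norm2 /dot big1 ?sqrtr0// => i _; rewrite mxE mul0r.
rewrite sqrtr_eq0 => x0; have : dot x x == 0 by rewrite eq_le x0 dot_ge0.
rewrite psumr_eq0 => [/allP h|i _]; last by rewrite -expr2 sqr_ge0.
apply/rowP => i; rewrite mxE; apply/eqP.
by have := h i (mem_index_enum _); rewrite mulf_eq0 orbb.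
Qed.

(** The squared length of [norm2 y ^+ 2 *: x - dot x y *: y] is nonnegative and equals |y|^2 (|x|^2
    |y|^2 - <x, y>^2). *)
Lemma CauchySchwarz_dot x y : dot x y <= norm2 x * norm2 y.
Proof.
have [->|y0] := eqVneq y 0.
  rewrite [X in X <= _](_ : _ = 0) ?mulr_ge0 ?norm2_ge0//.
  by rewrite /dot big1 // => i _; rewrite mxE mulr0.
have dy0 : 0 < norm2 y by rewrite lt_neqAle eq_sym norm2_eq0 y0 norm2_ge0.
have := dot_ge0 (norm2 y ^+ 2 *: x - dot x y *: y).
rewrite dotDl !dotDr !dotNl !dotNr !dotZl !dotZr -!sqr_norm2 (dotC y x) => h.
have h2 : dot x y ^+ 2 <= (norm2 x * norm2 y) ^+ 2.
  have : 0 < norm2 y ^+ 2 by rewrite exprn_gt0.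
  nra.
have [d0|d0] := ltP (dot x y) 0; last by rewrite -ler_sqr ?nnegrE ?mulr_ge0 ?norm2_ge0.
by rewrite (le_trans (ltW d0))// mulr_ge0 ?norm2_ge0.
Qed.

Lemma ler_norm_dot x y : `|dot x y| <= norm2 x * norm2 y.
Proof.
rewrite ler_norml CauchySchwarz_dot andbT lerNl -dotNl -(norm2N x).
exact: CauchySchwarz_dot.
Qed.

(** The library norm on row vectors is the largest absolute coordinate. It governs balls and limits
    below, while [norm2] appears in the Lipschitz estimates. *)
Lemma coord_le_norm x i : `|x 0 i| <= `|x|.
Proof.
rewrite {2}/Num.norm /= mx_normrE.
exact: (@le_bigmax _ _ _ _ (fun ij : 'I_1 * 'I_N => `|x ij.1 ij.2|) (0, i)).
Qed.

Lemma norm_le_coord x (c : R) : 0 <= c -> (forall i, `|x 0 i| <= c) -> `|x| <= c.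
Proof.
move=> c0 h; rewrite {1}/Num.norm /= mx_normrE; apply/bigmax_leP; split=> //.
by case=> i j _ /=; rewrite ord1.
Qed.

Lemma coord_le_norm2 x i : `|x 0 i| <= norm2 x.
Proof.
rewrite -sqrtr_sqr ler_sqrt ?dot_ge0// /dot (bigD1 i)//= -expr2 lerDl.
by apply: sumr_ge0 => j _; rewrite -expr2 sqr_ge0.
Qed.

Lemma norm_le_norm2 x : `|x| <= norm2 x.
Proof. by apply: norm_le_coord => [|i]; [exact: norm2_ge0|exact: coord_le_norm2]. Qed.

Lemma ler_norm_dot_sum x y : `|dot x y| <= `|x| * \sum_(i < N) `|y 0 i|.
Proof.
rewrite mulr_sumr (le_trans (ler_norm_sum _ _ _))// ler_sum// => i _.
by rewrite normrM ler_wpM2r// coord_le_norm.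
Qed.

Lemma norm2_le_norm x : norm2 x <= N%:R * `|x|.
Proof.
rewrite -(@ler_sqr _ (norm2 x)) ?nnegrE ?norm2_ge0 ?mulr_ge0// sqr_norm2.
rewrite (le_trans (ler_norm _))// (le_trans (ler_norm_dot_sum _ _))//.
have h : \sum_(i < N) `|x 0 i| <= N%:R * `|x|.
  rewrite -[X in X%:R]card_ord mulr_natl -sumr_const ler_sum// => i _.
  exact: coord_le_norm.
rewrite (le_trans (ler_wpM2l (normr_ge0 _) h))// mulrCA exprMn -expr2.
rewrite ler_wpM2r ?sqr_ge0// -natrX ler_nat.
by case: (N) => // n'; rewrite expnS leq_pmulr.
Qed.

End Euclidean.

(** * Compactness arguments and attained minima *)

Section Compactness.
Variable R : realType.

Lemma continuous_norm_ltP (V : normedModType R) (f : V -> R) (x : V) :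
  {for x, continuous f} <->
  forall e : R, 0 < e -> exists2 d : R, 0 < d &
    forall y, `|y - x| < d -> `|f y - f x| < e.
Proof.
split=> [cf e e0|h].
  have /nbhs_normP[d /= d0 hd] : \forall y \near x, `|f x - f y| < e.
    exact: (@cvgr_dist_lt _ _ _ _ _ _ _ cf e e0).
  by exists d => // y yx; rewrite distrC; apply: hd; rewrite /= distrC.
apply/(@cvgrPdist_lt _ _ _ (nbhs x)) => e /h[d d0 hd].
apply/nbhs_normP; exists d => // y /=; rewrite distrC => /hd.
by rewrite distrC.
Qed.

(* P may use rho both as a radius and as the inverse of a Lipschitz constant. *)
Lemma compact_uniform (V : normedModType R) (K : set V) (P : R -> V -> Prop) :
  compact K ->
  (forall rho rho' x, rho' <= rho -> P rho x -> P rho' x) ->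
  (forall x, K x -> exists2 rho : R, 0 < rho & forall y, `|y - x| < rho -> P rho y) ->
  exists2 rho : R, 0 < rho & forall x, K x -> P rho x.
Proof.
move=> cK Pmono Ploc.
(* Near-covering form of compactness: what holds near each point of [K] for all small [rho] holds on
   all of [K] for small [rho]. *)
have H : \forall rho \near (0 : R)^'+, K `<=` P rho.
  move/compact_near_coveringP : cK; apply => x Kx.
  have [rho rho0 hrho] := Ploc x Kx.
  exists ([set y | `|x - y| < rho], [set r : R | r <= rho]) => /=.
    split; last exact: nbhs_right_le.
    by apply/nbhs_normP; exists rho.
  move=> [y r] /= [xy rr]; apply: (Pmono rho) => //.
  by apply: hrho; rewrite distrC.
near (0 : R)^'+ => rho; exists rho => // x Kx.
suff : K `<=` P rho by exact.
by near: rho.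
Unshelve. all: by end_near. Qed.

Lemma compact_rV_sublevel (N : nat) (q : 'rV[R]_N -> R) (c C : R) :
  continuous q -> (forall x, q x <= c -> `|x| <= C) -> compact [set x | q x <= c].
Proof.
move=> cq qC; apply: bounded_closed_compact.
  exists C; split; first exact: num_real.
  by move=> M /ltW CM x /= /qC /le_trans; apply.
apply: (@preimage_closed _ _ q [set x | x <= c]); last exact: closed_le.
by move=> x _; exact: cq.
Qed.

Lemma compact_argmin (T : topologicalType) (A : set T) (f : T -> R) :
  A !=set0 -> compact A -> continuous f ->
  exists2 c, A c & forall t, A t -> f c <= f t.
Proof.
move=> A0 cA cf; have [|c cA' hc] := @compact_EVT_min _ _ f _ A0 cA.
  exact: continuous_subspaceT.
by exists c => [|t At]; [rewrite -in_setE|apply: hc; rewrite in_setE].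
Qed.

Lemma continuous_sumr (T : topologicalType) (I : Type) (r : seq I) (P : pred I)
    (f : I -> T -> R) :
  (forall i, continuous (f i)) -> continuous (fun x => \sum_(i <- r | P i) f i x).
Proof.
move=> cf x; elim: r => [|i r IH].
  under eq_fun do rewrite big_nil; exact: cst_continuous.
under eq_fun do rewrite big_cons; case: (P i) => //.
by apply: continuousD => //; exact: cf.
Qed.

Lemma continuous_dot (N : nat) (a : 'rV[R]_N) : continuous (dot a).
Proof.
apply: continuous_sumr => i x; apply: continuousM; first exact: cst_continuous.
exact: coord_continuous.
Qed.

End Compactness.

(** * Equivalence of norms in finite dimension *)

Section NormEquivalence.
Variables (R : realType) (N : nat) (nrm : 'rV[R]_N -> R).
Hypothesis nrmP : is_norm nrm.

Lemma is_norm0 : nrm 0 = 0.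
Proof.
by case: nrmP => _ hZ _; rewrite -[X in nrm X](scale0r 0) hZ normr0 mul0r.
Qed.

Lemma is_norm_ge0 x : 0 <= nrm x.
Proof.
case: nrmP => _ hZ hD; have := hD x (- x); rewrite subrr is_norm0.
by rewrite -scaleN1r hZ normrN1 mul1r -mulr2n pmulrn_lge0.
Qed.

(** Expand [x] in the standard basis; the constant is the sum of the norms of the basis vectors. *)
Lemma is_norm_le : exists2 C : R, 0 <= C & forall x, nrm x <= C * `|x|.
Proof.
case: nrmP => _ hZ hD.
exists (\sum_(i < N) nrm (delta_mx 0 i)).
  by apply: sumr_ge0 => i _; exact: is_norm_ge0.
move=> x; rewrite {1}(row_sum_delta x).
have hs (r : seq 'I_N) (h : 'I_N -> 'rV[R]_N) :
    nrm (\sum_(i <- r) h i) <= \sum_(i <- r) nrm (h i).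
  elim: r => [|i r IH]; first by rewrite !big_nil is_norm0.
  by rewrite !big_cons (le_trans (hD _ _))// lerD2l.
rewrite (le_trans (hs _ _))// mulr_suml ler_sum// => i _.
by rewrite hZ mulrC ler_wpM2l ?is_norm_ge0// coord_le_norm.
Qed.

Lemma is_norm_continuous : continuous nrm.
Proof.
have [C C0 hC] := is_norm_le; case: nrmP => _ hZ hD.
move=> x; apply/continuous_norm_ltP => e e0.
have C1 : 0 < C + 1 by rewrite ltr_wpDl.
exists (e / (C + 1)); first by rewrite divr_gt0.
move=> y; rewrite ltr_pdivlMr// => hy.
have h1 := hD (y - x) x; have h2 := hD (x - y) y.
have h3 := hC (y - x); have h4 := hC (x - y).
rewrite !subrK in h1 h2; rewrite (distrC x y) in h4.
have := normr_ge0 (y - x); rewrite ltr_norml; nra.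
Qed.

(** By compactness [nrm] attains a positive minimum on the unit sphere of the sup norm; its inverse
    is the constant. *)
Lemma is_norm_ge : exists2 C : R, 0 < C & forall x, `|x| <= C * nrm x.
Proof.
case: (nrmP) => h0 hZ hD.
pose S : set 'rV[R]_N := [set x | `|x| = 1].
have scale_S x : x != 0 -> S (`|x|^-1 *: x).
  move=> x0; rewrite /S /= normrZ ger0_norm ?invr_ge0//.
  by rewrite mulVf// normr_eq0.
(* The sphere is empty in dimension 0, where 0 is the only vector. *)
have [S0|S0] := pselect (S !=set0); last first.
  exists 1 => // x; have [->|/scale_S xS] := eqVneq x 0.
    by rewrite normr0 is_norm0 mulr0.
  by case: S0; exists (`|x|^-1 *: x).
have cS : compact S.
  apply: bounded_closed_compact.
    exists 1; split; first exact: num_real.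
    by move=> M /ltW M1 x /= ->.
  apply: (@preimage_closed _ _ (fun x : 'rV[R]_N => `|x|) [set x | x = 1]).
    by move=> x _; exact: norm_continuous.
  exact: closed_eq.
have [c Sc hc] := compact_argmin S0 cS is_norm_continuous.
have c0 : 0 < nrm c.
  rewrite lt_neqAle is_norm_ge0 andbT eq_sym; apply/eqP => /h0 c0.
  by move: Sc; rewrite /S /= c0 normr0 => /eqP; rewrite eq_sym oner_eq0.
exists (nrm c)^-1; first by rewrite invr_gt0.
move=> x; have [->|x0] := eqVneq x 0; first by rewrite normr0 is_norm0 mulr0.
have := hc _ (scale_S x x0); rewrite hZ ger0_norm ?invr_ge0//.
have x1 : 0 < `|x| by rewrite normr_gt0.
by rewrite mulrC ler_pdivlMr// [in X in X -> _]mulrC -ler_pdivlMr// mulrC.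
Qed.

Lemma dual_norm_attained (a : 'rV[R]_N) :
  exists2 w, nrm w <= 1 & forall w', nrm w' <= 1 -> dot a w' <= dot a w.
Proof.
have [C C0 hC] := is_norm_ge.
have cB : compact [set w | nrm w <= 1].
  apply: (@compact_rV_sublevel _ _ _ _ C is_norm_continuous) => x x1.
  by rewrite (le_trans (hC x))// ler_piMr// ltW.
have B0 : [set w | nrm w <= 1] !=set0 by exists 0; rewrite /= is_norm0.
have [|w wB hw] := @compact_argmin _ _ _ (fun w => dot (- a) w) B0 cB.
  exact: continuous_dot.
by exists w => // w' /hw; rewrite !dotNl lerN2.
Qed.

End NormEquivalence.

(** * Convex hull of a finite family and separation from it *)

Section ConvexHull.
Variables (R : realType) (N : nat) (T : finType) (P : T -> 'rV[R]_N).

(** Weights belong to indices rather than to points, so that they can later be regrouped by active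
    piece. *)
Definition in_hull (v : 'rV[R]_N) : Prop :=
  exists l : T -> R, [/\ forall t, 0 <= l t, \sum_t l t = 1 & v = \sum_t l t *: P t].

(** If <d, a> were positive, a short step along [a] would shorten [d], since |d - e a|^2 = |d|^2 - 2
    e <d, a> + e^2 |a|^2. *)
Lemma nearest_direction_dot (d a : 'rV[R]_N) :
  (forall e, 0 <= e <= 1 -> dot d d <= dot (d - e *: a) (d - e *: a)) ->
  dot d a <= 0.
Proof.
move=> step; rewrite leNgt; apply/negP => da0.
have aa0 := dot_ge0 a.
(* Adding [dot d a] to the denominator keeps it positive and gives both e <= 1 and e |a|^2 < 2 <d,
   a>. *)
pose e := dot d a / (dot a a + dot d a).
have den : 0 < dot a a + dot d a by rewrite ltr_wpDl.
have e0 : 0 < e by rewrite divr_gt0.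
have e1 : e <= 1 by rewrite ler_pdivrMr// mul1r lerDr.
have /step : 0 <= e <= 1 by rewrite (ltW e0).
rewrite dotDl !dotDr !dotNl !dotNr !dotZl !dotZr (dotC a d).
have : e * (dot a a + dot d a) = dot d a by rewrite divfK ?gt_eqF.
nra.
Qed.

(* d is the vector from the point of the hull nearest to v to the point v *)
Lemma hull_separation (t0 : T) (v : 'rV[R]_N) : ~ in_hull v ->
  exists2 d, d != 0 & forall t, dot (P t) d + norm2 d ^+ 2 <= dot v d.
Proof.
move=> nv.
(* The simplex of weights, written as row vectors through the enumeration of [T], is compact; the
   squared distance from [v] is minimized over it. *)
pose S : set 'rV[R]_#|T| := [set l | forall i, `[0 : R, 1]%classic (l ord0 i)]
  `&` (fun l => \sum_i l 0 i) @^-1` [set x | x = 1].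
have cS : compact S.
  apply: compact_closedI; first apply: (@rV_compact _ _ (fun=> `[0 : R, 1]%classic)) => _.
    exact: segment_compact.
  apply: (@preimage_closed _ _ (fun l : 'rV[R]_#|T| => \sum_i l 0 i));
    last exact: closed_eq.
  by move=> x _; apply: continuous_sumr => i {}x; exact: coord_continuous.
pose q (l : 'rV[R]_#|T|) := \sum_i l 0 i *: P (enum_val i).
pose D (l : 'rV[R]_#|T|) := dot (v - q l) (v - q l).
have S0 : S !=set0.
  exists (delta_mx 0 (enum_rank t0)); split => /=.
    by move=> i; rewrite mxE eqxx /= in_itv /=; case: eqP => _ /=; rewrite ?lexx ler01.
  rewrite (bigD1 (enum_rank t0))//= big1 ?mxE ?eqxx ?addr0// => i it.
  by rewrite mxE (negbTE it) andbF.
have cD : continuous D.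
  apply: continuous_sumr => j; suff cj : continuous (fun l => (v - q l) 0 j).
    by move=> l; apply: continuousM; exact: cj.
  move=> l; under eq_fun do rewrite !mxE summxE.
  apply: continuousB; first exact: cst_continuous.
  apply: continuous_sumr => i {}l; under eq_fun do rewrite mxE.
  by apply: continuousM; [exact: coord_continuous|exact: cst_continuous].
have [l [lS l1] lmin] := compact_argmin S0 cS cD.
exists (v - q l).
  apply/eqP => vq; apply: nv; exists (fun t => l 0 (enum_rank t)); split.
  - by move=> t; have := lS (enum_rank t); rewrite /= in_itv /= => /andP[].
  - rewrite -l1 /= (reindex (@enum_val T T)); last exact/onW_bij/enum_val_bij.
    by apply: eq_bigr => i _; rewrite enum_valK.
  - rewrite (subr0_eq vq) /q (reindex (@enum_rank T))/=; last exact/onW_bij/enum_rank_bij.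
    by apply: eq_bigr => i _; rewrite enum_rankK.
move=> t; set d := v - q l.
(* Shifting weight [e] from the optimal [l] to the vertex of [t] stays in the simplex and moves the
   nearest point towards [P t]. *)
have step e : 0 <= e <= 1 -> dot d d <= dot (d - e *: (P t - q l)) (d - e *: (P t - q l)).
  move=> /andP[e0 e1].
  pose l' := (1 - e) *: l + e *: delta_mx 0 (enum_rank t).
  have ql' : q l' = (1 - e) *: q l + e *: P t.
    rewrite /q (eq_bigr (fun i => (1 - e) *: (l 0 i *: P (enum_val i)) +
        e *: ((i == enum_rank t)%:R *: P (enum_val i)))).
      rewrite big_split -!scaler_sumr /=; congr (_ + _ *: _).
      rewrite (bigD1 (enum_rank t))//= eqxx scale1r enum_rankK big1 ?addr0//.
      by move=> i /negbTE->; rewrite scale0r.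
    by move=> i _; rewrite !mxE eqxx /= !scalerA -scalerDl.
  have -> : d - e *: (P t - q l) = v - q l'.
    by rewrite ql' /d scalerBr scalerBl scale1r; apply/rowP => i; rewrite !mxE; ring.
  apply: lmin; split => /=.
    move=> i; have := lS i; rewrite /= !in_itv /= !mxE eqxx /= => /andP[a b].
    by case: (i == _) => /=; rewrite ?mulr1 ?mulr0; apply/andP; split; nra.
  rewrite (eq_bigr (fun i => (1 - e) * l 0 i + e * (i == enum_rank t)%:R)); last first.
    by move=> i _; rewrite !mxE eqxx.
  rewrite big_split -!mulr_sumr /= [X in _ * X + _]l1.
  rewrite (bigD1 (enum_rank t))//= eqxx big1 => [|i /negbTE->//].
  by rewrite addr0 !mulr1 subrK.
set a := P t - q l in step.
have dda := nearest_direction_dot step.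
rewrite sqr_norm2 (dotC (P t)) (dotC v).
have hd : dot d d = dot d v - dot d (q l) by rewrite -dotNr -dotDr.
have hP : dot d a = dot d (P t) - dot d (q l) by rewrite -dotNr -dotDr.
by lra.
Qed.

End ConvexHull.

(** * Increments of smooth functions and of their finite maxima *)

Section MaxFunctions.
Variable R : realType.

(** Finite counterpart of [compact_uniform]: the radius is taken small enough for all indices at
    once. *)
Lemma common_radius (T : finType) (P : T -> R -> Prop) :
  (forall t d d', d' <= d -> P t d -> P t d') ->
  (forall t, exists2 d : R, 0 < d & P t d) ->
  exists2 d : R, 0 < d & forall t, P t d.
Proof.
move=> Pmono Ploc.
have H : \forall d \near (0 : R)^'+, forall t, P t d.
  apply: filter_forall => t; have [d d0 Pd] := Ploc t.
  by apply: filterS (nbhs_right_le d0) => d' d'd; exact: (Pmono t d).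
near (0 : R)^'+ => d; exists d => //.
by near: d.
Unshelve. all: by end_near. Qed.

Lemma le_fmax (N : nat) (F : 'I_N -> R) (i : 'I_N) : F i <= fmax F.
Proof. by case: N F i => [|N] F i; [case: i|exact: le_bigmax]. Qed.

Lemma fmax_attained (N : nat) (F : 'I_N -> R) :
  (0 < N)%N -> exists i, fmax F = F i.
Proof.
case: N F => // N F _ /=; apply: (big_ind (fun y => exists i, y = F i)).
- by exists ord0.
- by move=> _ _ [i ->] [j ->]; rewrite maxEle; case: ifP; [exists j|exists i].
- by move=> i _; exists i.
Qed.

Lemma continuous_fmax (T : topologicalType) (N : nat) (F : 'I_N -> T -> R) :
  (forall i, continuous (F i)) -> continuous (fun x => fmax (fun i => F i x)).
Proof.
case: N F => [|N] F cF /=; first by move=> x; exact: cst_continuous.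
move=> x; elim: (index_enum _) => [|i r IH].
  under eq_fun do rewrite big_nil; exact: cF.
under eq_fun do rewrite big_cons /=.
by apply: continuous_max => //; exact: cF.
Qed.

Lemma is_derive_line (V : normedModType R) (F : V -> R) (a v : V) (t : R) :
  differentiable F (a + t *: v) ->
  is_derive t 1 (fun t => F (a + t *: v)) ('d F (a + t *: v) v).
Proof.
move=> dF; have E : (fun h => h^-1 *: (((fun t => F (a + t *: v)) \o shift t) (h *: 1)
     - F (a + t *: v))) = (fun h => h^-1 *: ((F \o shift (a + t *: v)) (h *: v)
     - F (a + t *: v))).
  apply/funext => h /=; congr (_ *: (F _ - _)).
  by rewrite scalerDl -[h *: 1]/(h * 1) mulr1 addrCA addrA.
apply: DeriveDef.
  by rewrite /derivable E; exact: diff_derivable.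
by rewrite /derive E -deriveE.
Qed.

Lemma diff_scaler (V : normedModType R) (F : V -> R) (z v : V) (c : R) :
  'd F z (c *: v) = c * 'd F z v.
Proof. by rewrite linearZ. Qed.

Lemma diff_coord (a b : nat) (F : 'rV[R]_a * 'rV[R]_b -> R) z (h : 'rV[R]_a) :
  'd F z (h, 0) = \sum_(j < a) h 0 j * 'd F z (delta_mx 0 j, 0).
Proof.
have hE : (h, 0) = \sum_(j < a) h 0 j *: (delta_mx 0 j, 0) :> 'rV[R]_a * 'rV[R]_b.
  rewrite [RHS]surjective_pairing (raddf_sum (@fst 'rV[R]_a 'rV[R]_b)).
  rewrite (raddf_sum (@snd 'rV[R]_a 'rV[R]_b)) /= -row_sum_delta.
  by congr (_, _); rewrite big1 // => j _; rewrite scaler0.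
rewrite {1}hE linear_sum; apply: eq_bigr => j _.
exact: diff_scaler.
Qed.

(** Mean value theorem on the segment from [(u, x)] to [(u', x)]; continuity of the partial
    derivatives allows the gradient to be frozen at [(u0, x0)], uniformly in [x] near [x0]. *)
Lemma C1_increment (a b : nat) (F : 'rV[R]_a * 'rV[R]_b -> R)
    (u0 : 'rV[R]_a) (x0 : 'rV[R]_b) (e : R) :
  C1 F -> 0 < e -> exists2 d : R, 0 < d & forall u u' x,
    `|u - u0| < d -> `|u' - u0| < d -> `|x - x0| < d ->
    F (u', x) - F (u, x) <= dot (grad1 F u0 x0) (u' - u) + e * `|u' - u|.
Proof.
(* Each of the [a] partial derivatives may err by [e']; the successor avoids a zero denominator when
   [a] is 0. *)
move=> [dF cF] e0; pose e' := e / a.+1%:R.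
have e'0 : 0 < e' by rewrite divr_gt0// ltr0n.
have [d d0 hd] : exists2 d : R, 0 < d & forall j : 'I_a, forall z,
    `|z - (u0, x0)| < d ->
    `|'d F z (delta_mx 0 j, 0) - 'd F (u0, x0) (delta_mx 0 j, 0)| < e'.
  apply: common_radius => [j d d' dd' h z zd|j].
    by apply: h; exact: lt_le_trans dd'.
  exact: ((continuous_norm_ltP _ _).1 (cF (delta_mx 0 j, 0) (u0, x0))).
exists d => // u u' x ud u'd xd.
pose h : 'rV[R]_a := u' - u; pose h0 : 'rV[R]_a * 'rV[R]_b := (h, 0).
have line (t : R) : (u, x) + t *: h0 = (u + t *: h, x) :> 'rV[R]_a * 'rV[R]_b.
  by congr (_, _) => /=; rewrite scaler0 addr0.
have der (t : R) : is_derive t 1 (fun t : R => F ((u, x) + t *: h0))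
    ('d F ((u, x) + t *: h0) h0) by exact: is_derive_line.
have [|t] := @MVT_segment _ _ _ 0 1 ler01 (fun t _ => der t).
  by apply: derivable_within_continuous => t _; have [] := der t.
rewrite in_itv /= => /andP[t0 t1].
have uh : u + h = u' by rewrite /h addrC subrK.
rewrite !line scale1r scale0r addr0 uh subr0 mulr1 => ->.
(* The intermediate point is a convex combination of the endpoints, hence stays in the ball. *)
have tz : `|(u + t *: h, x) - (u0, x0)| < d.
  rewrite prod_normE /= gt_max xd andbT.
  have -> : u + t *: h - u0 = (1 - t) *: (u - u0) + t *: (u' - u0).
    by rewrite /h; apply/rowP => j; rewrite !mxE; ring.
  have t1' : 0 <= 1 - t by rewrite subr_ge0.
  rewrite (le_lt_trans (ler_normD _ _))// !normrZ (ger0_norm t0) (ger0_norm t1').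
  have M1 : Num.max `|u - u0| `|u' - u0| < d by rewrite gt_max ud.
  apply: le_lt_trans M1; set M := Num.max _ _.
  have A : `|u - u0| <= M by rewrite le_max lexx.
  have B : `|u' - u0| <= M by rewrite le_max lexx orbT.
  by nra.
rewrite diff_coord /dot -lerBlDl -sumrB.
have : \sum_(j < a) `|h 0 j| * e' <= e * `|u' - u|.
  rewrite -mulr_suml.
  have hs : \sum_(j < a) `|h 0 j| <= a.+1%:R * `|h|.
    rewrite -natr1 mulrDl mul1r ler_wpDr// -[X in X%:R]card_ord mulr_natl -sumr_const.
    by apply: ler_sum => j _; exact: coord_le_norm.
  by rewrite mulrC (le_trans (ler_wpM2l (ltW e'0) hs))// mulrA divfK.
apply: le_trans; apply: ler_sum => j _.
have -> : grad1 F u0 x0 0 j = 'd F (u0, x0) (delta_mx 0 j, 0) by rewrite mxE.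
rewrite -/h (mulrC _ (h 0 j)) -mulrBr.
rewrite (le_trans (ler_norm _))// normrM ler_wpM2l//.
exact/ltW/hd.
Qed.

(** Take [i] attaining the maximum at [(u', x)]: the increment of the maximum is at most that of
    piece [i], and near [(u0, x0)] only pieces active there can attain the maximum. *)
Lemma fmax_increment (a b N : nat) (h : 'I_N -> 'rV[R]_a -> 'rV[R]_b -> R)
    (u0 : 'rV[R]_a) (x0 : 'rV[R]_b) (e : R) :
  (0 < N)%N -> (forall i, C1 (fun z : 'rV[R]_a * 'rV[R]_b => h i z.1 z.2)) ->
  0 < e -> exists2 d : R, 0 < d & forall u u' x,
    `|u - u0| < d -> `|u' - u0| < d -> `|x - x0| < d ->
    exists2 i, h i u0 x0 = fmax (fun j => h j u0 x0) &
      fmax (fun j => h j u' x) - fmax (fun j => h j u x) <=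
      dot (grad1 (fun z : 'rV[R]_a * 'rV[R]_b => h i z.1 z.2) u0 x0) (u' - u)
        + e * `|u' - u|.
Proof.
move=> N0 hC e0.
have [d1 d10 hd1] : exists2 d : R, 0 < d & forall i : 'I_N, forall u u' x,
    `|u - u0| < d -> `|u' - u0| < d -> `|x - x0| < d ->
    h i u' x - h i u x <=
    dot (grad1 (fun z : 'rV[R]_a * 'rV[R]_b => h i z.1 z.2) u0 x0) (u' - u)
        + e * `|u' - u|.
  apply: common_radius => [i d d' dd' H u u' x ud u'd xd|i].
    by apply: H; exact: lt_le_trans dd'.
  exact: (C1_increment u0 x0 (hC i) e0).
have [i0 hi0] := fmax_attained (fun j => h j u0 x0) N0.
(* By continuity, pieces strictly below the active piece [i0] at [(u0, x0)] remain below it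
   nearby. *)
have [d2 d20 hd2] : exists2 d : R, 0 < d & forall i : 'I_N, forall u x,
    `|u - u0| < d -> `|x - x0| < d -> h i u0 x0 < h i0 u0 x0 -> h i u x < h i0 u x.
  apply: common_radius => [i d d' dd' H u x ud xd|i].
    by apply: H; exact: lt_le_trans dd'.
  have [lt_i|] := ltP (h i u0 x0) (h i0 u0 x0); last by exists 1.
  pose D (z : 'rV[R]_a * 'rV[R]_b) := h i0 z.1 z.2 - h i z.1 z.2.
  have cD : {for (u0, x0), continuous D}.
    by apply: continuousB; apply: differentiable_continuous; exact: (hC _).1.
  have [d d0 hd] := (continuous_norm_ltP _ _).1 cD (D (u0, x0))
    (ltac:(by rewrite subr_gt0)).
  exists d => // u x ud xd _; rewrite -subr_gt0.
  have := hd (u, x); rewrite prod_normE /= gt_max ud xd => /(_ isT).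
  by rewrite /D /= ltr_distlC => /andP[]; lra.
exists (Num.min d1 d2) => [|u u' x]; first by rewrite lt_min d10.
rewrite !lt_min => /andP[u1 u2] /andP[u'1 u'2] /andP[x1 x2].
have [i hi] := fmax_attained (fun j => h j u' x) N0.
exists i.
  apply/le_anti; rewrite le_fmax /= hi0 leNgt; apply/negP => /(hd2 i u' x u'2 x2).
  by rewrite ltNge -hi le_fmax.
rewrite hi (le_trans _ (hd1 i u u' x u1 u'1 x1))// lerD2l lerN2.
exact: (le_fmax (fun j => h j u x)).
Qed.

End MaxFunctions.

(** * Block structure of the parameter and maximizers on dual unit balls *)

Section Blocks.
Variables (R : realType) (s : nat) (m : 'I_s -> nat).
Implicit Types (u : 'rV[R]_(\sum_(k < s) m k)) (z : 'rV[R]_((\sum_(k < s) m k) + 1)).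

Lemma dot_blocks u u' : dot u u' = \sum_(k < s) dot (submxrow u k) (submxrow u' k).
Proof.
have dotE N (x y : 'rV[R]_N) : dot x y = (x *m y^T) 0 0.
  by rewrite mxE; apply: eq_bigr => i _; rewrite mxE.
rewrite dotE -{1}(submxrowK u) -{1}(submxrowK u') tr_mxrow mul_mxrow_mxcol summxE.
by apply: eq_bigr => k _; rewrite dotE.
Qed.

Lemma dot_row_mx1 (N : nat) (z z' : 'rV[R]_(N + 1)) :
  dot z z' = dot (lsubmx z) (lsubmx z') + rsubmx z 0 0 * rsubmx z' 0 0.
Proof.
rewrite /dot big_split_ord big_ord1 /=; congr (_ + _).
  by apply: eq_bigr => i _; rewrite !mxE.
by rewrite !mxE.
Qed.

Lemma norm_submxrow u k : `|submxrow u k| <= `|u|.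
Proof. by apply: norm_le_coord => // i; rewrite mxE coord_le_norm. Qed.

Lemma norm_lsubmx (N : nat) (z : 'rV[R]_(N + 1)) : `|lsubmx z| <= `|z|.
Proof. by apply: norm_le_coord => // i; rewrite mxE coord_le_norm. Qed.

Lemma norm_rsubmx (N : nat) (z : 'rV[R]_(N + 1)) : `|rsubmx z 0 0| <= `|z|.
Proof. by rewrite mxE coord_le_norm. Qed.

Lemma sqr_norm2_block z k :
  norm2 (submxrow (lsubmx z) k) ^+ 2 + rsubmx z 0 0 ^+ 2 <= norm2 z ^+ 2.
Proof.
rewrite !sqr_norm2 dot_row_mx1 -expr2 lerD2r dot_blocks.
rewrite [leRHS](bigD1 k)//= lerDl.
by apply: sumr_ge0 => j _; exact: dot_ge0.
Qed.

(** A point of the unit ball where the dual norm of [a] is attained, chosen as a function of [a]. *)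
Definition dual_arg (N : nat) (nrm : 'rV[R]_N -> R) (a : 'rV[R]_N) : 'rV[R]_N :=
  xget 0 [set w | nrm w <= 1 /\ forall w', nrm w' <= 1 -> dot a w' <= dot a w].

Lemma dual_argP (N : nat) (nrm : 'rV[R]_N -> R) (a : 'rV[R]_N) : is_norm nrm ->
  nrm (dual_arg nrm a) <= 1 /\
  forall w, nrm w <= 1 -> `|dot a w| <= dot a (dual_arg nrm a).
Proof.
move=> nP; have [w w1 hw] := dual_norm_attained nP a.
have [d1 hd] := @xgetI _ 0 [set w | nrm w <= 1 /\
  forall w', nrm w' <= 1 -> dot a w' <= dot a w] w (conj w1 hw).
split=> // w' w'1; rewrite ler_norml hd// andbT lerNl -dotNr hd//.
by case: nP => _ hZ _; rewrite -scaleN1r hZ normrN1 mul1r.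
Qed.

End Blocks.

(** * The robust problem and the candidate slopes of its inner supremum *)

Section RobustMinValue.
Variables (R : realType) (n s : nat) (m r : 'I_s -> nat)
  (f0 : 'rV[R]_n -> R) (X : set 'rV[R]_n)
  (f : forall k : 'I_s, 'I_(r k) -> 'rV[R]_(m k) -> 'rV[R]_n -> R)
  (nrm : forall k : 'I_s, 'rV[R]_(m k) -> R)
  (ub : 'rV[R]_(\sum_(k < s) m k)).
Arguments f {k} _ _ _.
Arguments nrm {k} _.

Definition obj (v : 'rV[R]_(\sum_(k < s) m k)) (x : 'rV[R]_n) : R :=
  f0 x + \sum_(k < s) fmax (fun i => f i (submxrow v k) x).

Definition box (u : 'rV[R]_(\sum_(k < s) m k)) (delta : R) :=
  [set v : 'rV[R]_(\sum_(k < s) m k) |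
    forall k, nrm (submxrow v k - submxrow u k) <= `|delta|].

Definition worst (z : 'rV[R]_((\sum_(k < s) m k) + 1)) (x : 'rV[R]_n) : \bar R :=
  ereal_sup [set (obj v x)%:E | v in box (lsubmx z) (rsubmx z 0 0)].

Definition minval (z : 'rV[R]_((\sum_(k < s) m k) + 1)) : \bar R :=
  ereal_inf [set worst z x | x in X].

Definition argmins := [set xb | X xb /\ forall x, X x -> obj ub xb <= obj ub x].

Definition active (k : 'I_s) (x : 'rV[R]_n) (i : 'I_(r k)) : bool :=
  f i (submxrow ub k) x == fmax (fun j => f j (submxrow ub k) x).

Definition gradf (k : 'I_s) (i : 'I_(r k)) (x : 'rV[R]_n) : 'rV[R]_(m k) :=
  grad1 (fun z : 'rV[R]_(m k) * 'rV[R]_n => f i z.1 z.2) (submxrow ub k) x.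

Definition base : 'rV[R]_((\sum_(k < s) m k) + 1) := row_mx ub 0.

(** The dual norm of the gradient: the rate at which enlarging the ball in block [k] can raise piece
    [i] to first order. *)
Definition dual (k : 'I_s) (i : 'I_(r k)) (x : 'rV[R]_n) : R :=
  dot (gradf i x) (dual_arg (@nrm k) (gradf i x)).

(* a choice, for every k, of a piece f k i and of the sign of the slope in delta *)
Definition selection : finType := {dffun forall k : 'I_s, ('I_(r k) * bool)%type}.

Definition active_selection (x : 'rV[R]_n) (sg : selection) : bool :=
  [forall k, active x (sg k).1].

Definition slope (x : 'rV[R]_n) (sg : selection) : 'rV[R]_((\sum_(k < s) m k) + 1) :=
  row_mx (\mxrow_(k < s) gradf (sg k).1 x)
         (const_mx (\sum_(k < s) (-1) ^+ (sg k).2 * dual (sg k).1 x)).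

Lemma dot_slope x sg z : dot (slope x sg) z =
  \sum_(k < s) (dot (gradf (sg k).1 x) (submxrow (lsubmx z) k) +
                (-1) ^+ (sg k).2 * dual (sg k).1 x * rsubmx z 0 0).
Proof.
rewrite dot_row_mx1 row_mxKl row_mxKr mxE dot_blocks big_split /= mulr_suml.
by congr (_ + _); apply: eq_bigr => k _; rewrite mxrowK.
Qed.

Hypothesis f0lip : loc_lip (fun x => (f0 x)%:E).
Hypothesis X0 : X !=set0.
Hypothesis cX : compact X.
Hypothesis r0 : forall k, (0 < r k)%N.
Hypothesis fC1 : forall k (i : 'I_(r k)),
  C1 (fun z : 'rV[R]_(m k) * 'rV[R]_n => f i z.1 z.2).
Hypothesis nrmP : forall k, is_norm (@nrm k).

(** * First-order estimate for the inner supremum *)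

(** Any common bound [B] on the active slopes is allowed, so that one estimate serves both the
    Lipschitz constants and the separation argument for subgradients. *)
Lemma worst_increment xb (e : R) : 0 < e ->
  exists2 rho : R, 0 < rho & forall x z z' (B : R),
    `|x - xb| < rho -> `|z - base| < rho -> `|z' - base| < rho ->
    (forall sg, active_selection xb sg -> dot (slope xb sg) (z' - z) <= B) ->
    (worst z' x <= worst z x + (B + e * norm2 (z' - z))%:E)%E.
Proof.
move=> e0.
(* One constant for all blocks: [common_radius] is applied to the inverses of the constants. *)
have [C C0 hC] : exists2 C : R, 0 < C & forall k (w : 'rV[R]_(m k)),
    nrm w <= 1 -> `|w| <= C.
  have [d d0 hd] : exists2 d : R, 0 < d & forall k (w : 'rV[R]_(m k)),
      0 < d -> nrm w <= 1 -> `|w| <= d^-1.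
    apply: common_radius => [k d d' dd' H w d'0 w1|k].
      have d0 := lt_le_trans d'0 dd'.
      by rewrite (le_trans (H w d0 w1))// lef_pV2.
    have [C C0 hC] := is_norm_ge (nrmP k).
    exists C^-1; rewrite ?invr_gt0// => w _ w1.
    by rewrite invrK (le_trans (hC w))// ler_piMr// ltW.
  by exists d^-1; [rewrite invr_gt0|move=> k w; exact: hd].
have C1 : 0 < 1 + C by rewrite ltr_wpDl.
(* The [s] blocks contribute errors of at most [e1 * (1 + C) * norm2 (z' - z)] each; the successor
   of [s] covers the case [s = 0]. *)
pose e1 := e / (s.+1%:R * (1 + C)).
have e10 : 0 < e1 by rewrite divr_gt0// mulr_gt0// ltr0n.
have [d d0 hd] : exists2 d : R, 0 < d & forall k : 'I_s, forall u u' x,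
    `|u - submxrow ub k| < d -> `|u' - submxrow ub k| < d -> `|x - xb| < d ->
    exists2 i, active xb i &
      fmax (fun j => f j u' x) - fmax (fun j => f j u x) <=
      dot (gradf i xb) (u' - u) + e1 * `|u' - u|.
  apply: common_radius => [k d d' dd' H u u' x ud u'd xd|k].
    by apply: H; exact: lt_le_trans dd'.
  have [d d0 hd] := fmax_increment (submxrow ub k) xb (r0 k) (@fC1 k) e10.
  exists d => // u u' x ud u'd xd; have [i hi Hi] := hd u u' x ud u'd xd.
  by exists i => //; apply/eqP.
(* A change of [base] by less than [rho] moves each block by less than [rho], plus at most [rho * C]
   from the radius times [w k]. *)
pose rho := d / (1 + C).
have rho0 : 0 < rho by rewrite divr_gt0.
have rhod : rho * (1 + C) = d by rewrite divfK// gt_eqF.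
have rho_le : rho <= d by rewrite -rhod ler_peMr ?(ltW rho0)// lerDl ltW.
exists rho => // x z z' B xr zr z'r hB.
apply: ge_ereal_sup => _ [v' v'U <-].
pose del := rsubmx z 0 0; pose del' := rsubmx z' 0 0.
(* for del' = 0 the junk value 0^-1 = 0 gives w k = 0, as needed *)
pose w k := del'^-1 *: (submxrow v' k - submxrow (lsubmx z') k).
have w1 k : nrm (w k) <= 1.
  have := v'U k; rewrite -/del' /w; case: (nrmP k) => _ hZ _.
  have [->|d'0] := eqVneq del' 0; first by rewrite invr0 scale0r is_norm0.
  by rewrite hZ normfV mulrC ler_pdivrMr ?normr_gt0// mul1r.
have v'E k : submxrow v' k = submxrow (lsubmx z') k + del' *: w k.
  have := v'U k; rewrite -/del' /w.
  have [->|d'0] := eqVneq del' 0; last by rewrite scalerKV// subrKC.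
  rewrite normr0 scale0r addr0 => h.
  apply: subr0_eq; case: (nrmP k) => h0 _ _; apply: h0.
  by apply/le_anti; rewrite h is_norm_ge0.
(* The same directions [w] at the parameter [z]: then [v' - v] is linear in [z' - z]. *)
pose v : 'rV[R]_(\sum_(k < s) m k) := \mxrow_k (submxrow (lsubmx z) k + del *: w k).
have vE k : submxrow v k = submxrow (lsubmx z) k + del *: w k by rewrite mxrowK.
have vU : box (lsubmx z) del v.
  move=> k; rewrite vE addrAC subrr add0r; case: (nrmP k) => _ -> _.
  by rewrite ler_piMr.
have near_ub (y : 'rV[R]_((\sum_(k < s) m k) + 1)) k : `|y - base| < rho ->
    `|submxrow (lsubmx y) k + rsubmx y 0 0 *: w k - submxrow ub k| < d.
  move=> yr; rewrite addrAC -submxrowB (le_lt_trans (ler_normD _ _))//.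
  have -> : lsubmx y - ub = lsubmx (y - base) by rewrite linearB /= row_mxKl.
  have -> : rsubmx y 0 0 = rsubmx (y - base) 0 0.
    by rewrite linearB /= row_mxKr subr0.
  rewrite normrZ -rhod mulrDr mulr1 ltr_leD//.
    by rewrite (le_lt_trans _ yr)// (le_trans (norm_submxrow _ _))// norm_lsubmx.
  by rewrite ler_pM// ?hC// (le_trans (norm_rsubmx _))// ltW.
have step k : exists2 i, active xb i &
    fmax (fun j => f j (submxrow v' k) x) - fmax (fun j => f j (submxrow v k) x) <=
    dot (gradf i xb) (submxrow v' k - submxrow v k)
      + e1 * `|submxrow v' k - submxrow v k|.
  apply: hd; rewrite ?vE ?v'E; [exact: near_ub|exact: near_ub|].
  exact: lt_le_trans rho_le.
have [ik hik] : {ik : forall k : 'I_s, 'I_(r k) & forall k, active xb (ik k) /\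
    fmax (fun j => f j (submxrow v' k) x) - fmax (fun j => f j (submxrow v k) x) <=
    dot (gradf (ik k) xb) (submxrow v' k - submxrow v k)
      + e1 * `|submxrow v' k - submxrow v k|}.
  exists (fun k => sval (cid2 (step k))) => k.
  by case: (cid2 (step k)).
(* The sign is that of [del' - del], so the slope contributes [dual] times its absolute value, which
   dominates the term with [w k]. *)
pose sg : selection := [ffun k => (ik k, del' - del < 0)].
have sgE k : sg k = (ik k, del' - del < 0) by rewrite ffunE.
have sgA : active_selection xb sg.
  by apply/forallP => k; rewrite sgE; exact: (hik k).1.
have vvE k : submxrow v' k - submxrow v k =
    submxrow (lsubmx (z' - z)) k + (del' - del) *: w k.
  rewrite vE v'E linearB /= submxrowB scalerBl.
  by rewrite opprD addrACA.
have rE : rsubmx (z' - z) 0 0 = del' - del by rewrite /del /del' !mxE.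
have key : obj v' x <= obj v x + (B + e * norm2 (z' - z)).
  have main : obj v' x - obj v x <= \sum_(k < s)
      (dot (gradf (sg k).1 xb) (submxrow (lsubmx (z' - z)) k) +
       (-1) ^+ (sg k).2 * dual (sg k).1 xb * rsubmx (z' - z) 0 0
       + e1 * ((1 + C) * norm2 (z' - z))).
    rewrite /obj opprD addrACA subrr add0r -sumrB; apply: ler_sum => k _.
    rewrite sgE /= rE.
    have [_ h] := hik k; apply: (le_trans h); rewrite vvE; apply: lerD.
      rewrite dotDr lerD2l dotZr.
      have [_ /(_ _ (w1 k))] := dual_argP (gradf (ik k) xb) (nrmP k).
      rewrite -/(dual (ik k) xb) ler_norml => /andP[lo hi].
      have [neg|pos] := ltP (del' - del) 0.
        by rewrite expr1; nra.
      by rewrite expr0; nra.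
    rewrite ler_wpM2l ?(ltW e10)// mulrDl mul1r (le_trans (ler_normD _ _))//.
    have nz := norm_le_norm2 (z' - z).
    rewrite lerD//.
      by rewrite (le_trans (norm_submxrow _ _))// (le_trans (norm_lsubmx _)).
    rewrite normrZ mulrC ler_pM// ?hC// -rE.
    exact: le_trans (norm_rsubmx _) nz.
  rewrite -lerBlDl (le_trans main)// big_split /= -dot_slope lerD ?hB//.
  rewrite sumr_const card_ord -mulr_natl mulrCA !mulrA.
  rewrite ler_wpM2r ?norm2_ge0//.
  have -> : e = e1 * (s.+1%:R * (1 + C)) by rewrite divfK// mulf_neq0 ?gt_eqF// ltr0n.
  rewrite mulrA ler_wpM2r ?(ltW C1)// ler_wpM2l ?(ltW e10)// ler_nat.
  exact: leqnSn.
have : ((obj v x)%:E <= worst z x)%E.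
  by apply: ereal_sup_ubound; exists v.
move/(@leeD2r _ (B + e * norm2 (z' - z))%:E); apply: le_trans.
by rewrite -EFinD lee_fin.
Qed.

(** * Values and minimizers near the base point *)

Lemma continuous_f0 : continuous f0.
Proof.
move=> x; have [kap [kap0 [eps [eps0 hx]]]] := f0lip x.
apply/continuous_norm_ltP => e e0.
have n0 : 0 < n.+1%:R :> R by rewrite ltr0n.
have k1 : 0 < kap + 1 by rewrite ltr_wpDl.
exists (Num.min (eps / n.+1%:R) (e / ((kap + 1) * n.+1%:R))).
  by rewrite lt_min !divr_gt0// mulr_gt0.
move=> y; rewrite lt_min !ltr_pdivlMr ?mulr_gt0// => /andP[y1 y2].
have y3 : norm2 (y - x) <= `|y - x| * n.+1%:R.
  by rewrite (le_trans (norm2_le_norm _))// mulrC ler_wpM2l// ler_nat.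
have x0 : norm2 (x - x) <= eps.
  by rewrite subrr (eqP (_ : norm2 0 == 0)) ?norm2_eq0// ltW.
have /= [_] := hx y x (le_trans y3 (ltW y1)) x0.
move=> /le_lt_trans; apply.
have := norm2_ge0 (y - x); nra.
Qed.

Lemma continuous_obj v : continuous (obj v).
Proof.
move=> x; apply: continuousD; first exact: continuous_f0.
apply: continuous_sumr => k; apply: continuous_fmax => i {}x.
apply/continuous_norm_ltP => e e0.
have cf := differentiable_continuous ((fC1 i).1 (submxrow v k, x)).
have [d d0 hd] := (continuous_norm_ltP _ _).1 cf e e0.
exists d => // y yx; apply: (hd (submxrow v k, y)).
by rewrite prod_normE /= subrr normr0 gt_max d0.
Qed.

(** At radius 0 the box is the single point [ub], because a norm vanishes only at 0. *)
Lemma worst_base x : worst base x = (obj ub x)%:E.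
Proof.
rewrite /worst /base row_mxKl row_mxKr mxE.
rewrite (_ : [set (obj v x)%:E | v in _] = [set (obj ub x)%:E]) ?ereal_sup1//.
apply/seteqP; split => [_ [v vU <-] /=|_ ->].
  congr (obj _ x)%:E; apply/mxrowP => k; apply: subr0_eq.
  case: (nrmP k) => h0 _ _; apply: h0; apply/le_anti.
  by have := vU k; rewrite normr0 => ->; rewrite is_norm_ge0.
by exists ub => // k; rewrite subrr is_norm0 ?normr0.
Qed.

Lemma argmins_nonempty : exists xm, argmins xm.
Proof.
by have [xm Xm hm] := compact_argmin X0 cX (@continuous_obj ub); exists xm.
Qed.

Lemma minval_base xm : argmins xm -> minval base = (obj ub xm)%:E.
Proof.
move=> [Xm hm]; apply/le_anti/andP; split.
  by apply: ereal_inf_lbound; exists xm => //; exact: worst_base.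
apply: le_ereal_inf_tmp => _ [x Xx <-]; rewrite worst_base lee_fin.
exact: hm.
Qed.

Lemma minval_le z x : X x -> (minval z <= worst z x)%E.
Proof. by move=> Xx; apply: ereal_inf_lbound; exists x. Qed.

Lemma slope_bounded xb : exists2 K : R, 0 <= K &
  forall sg z, dot (slope xb sg) z <= K * norm2 z.
Proof.
exists (\sum_sg norm2 (slope xb sg)); first by apply: sumr_ge0 => sg _; exact: norm2_ge0.
move=> sg z; rewrite (le_trans (CauchySchwarz_dot _ _))// ler_wpM2r ?norm2_ge0//.
rewrite (bigD1 sg)//= lerDl; apply: sumr_ge0 => sg' _; exact: norm2_ge0.
Qed.

(** A crude constant, uniform over [X], that makes [minval] finite near [base] and excludes
    non-minimizers; the sharp constant comes later from minimizers alone. *)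
Lemma worst_lipschitz : exists2 rho : R, 0 < rho & exists2 K : R, 0 <= K &
  forall x z z', X x -> `|z - base| < rho -> `|z' - base| < rho ->
    (worst z' x <= worst z x + (K * norm2 (z' - z))%:E)%E.
Proof.
suff [rho rho0 H] : exists2 rho : R, 0 < rho & forall x, X x ->
    forall z z', `|z - base| < rho -> `|z' - base| < rho ->
    (worst z' x <= worst z x + (rho^-1 * norm2 (z' - z))%:E)%E.
  exists rho => //; exists rho^-1; first by rewrite invr_ge0 ltW.
  by move=> x z z' Xx; exact: H.
apply: compact_uniform => //.
- move=> rho rho' x le_rho H z z' zr z'r.
  have rho'0 : 0 < rho' by exact: le_lt_trans zr.
  have rho0 := lt_le_trans rho'0 le_rho.
  apply: le_trans (H z z' (lt_le_trans zr le_rho) (lt_le_trans z'r le_rho)) _.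
  rewrite leeD2l// lee_fin ler_wpM2r ?norm2_ge0//.
  by rewrite lef_pV2.
- move=> xb Xb; have [K K0 hK] := slope_bounded xb.
  have [rho rho0 H] := worst_increment xb ltr01.
  have K1 : 0 < K + 1 by rewrite ltr_wpDl.
  have m0 : 0 < Num.min rho (K + 1)^-1 by rewrite lt_min rho0 invr_gt0.
  exists (Num.min rho (K + 1)^-1) => // x xr z z' zr z'r.
  have lt_rho (a : R) : a < Num.min rho (K + 1)^-1 -> a < rho.
    by rewrite lt_min => /andP[].
  have := H x z z' (K * norm2 (z' - z)) (lt_rho _ xr) (lt_rho _ zr) (lt_rho _ z'r).
  move=> /(_ (fun sg _ => hK sg _)) /le_trans; apply.
  rewrite leeD2l// lee_fin -mulrDl ler_wpM2r ?norm2_ge0//.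
  rewrite -[leLHS]invrK lef_pV2 ?posrE ?invr_gt0//.
  by rewrite ge_min lexx orbT.
Qed.

(** An infimum of functions with a common Lipschitz constant inherits it. The estimate for [worst]
    is returned with the same [rho] and [K] for joint use. *)
Lemma minval_lipschitz : exists2 rho : R, 0 < rho & exists2 K : R, 0 <= K &
  (forall x z z', X x -> `|z - base| < rho -> `|z' - base| < rho ->
    (worst z' x <= worst z x + (K * norm2 (z' - z))%:E)%E) /\
  forall z z', `|z - base| < rho -> `|z' - base| < rho ->
    minval z \is a fin_num /\
    (minval z' <= minval z + (K * norm2 (z' - z))%:E)%E.
Proof.
have [rho rho0 [K K0 H]] := worst_lipschitz.
exists rho => //; exists K => //; split=> //.
have L z z' : `|z - base| < rho -> `|z' - base| < rho ->
    (minval z' <= minval z + (K * norm2 (z' - z))%:E)%E.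
  move=> zr z'r; rewrite -leeBlDr//; apply: le_ereal_inf_tmp => _ [x Xx <-].
  rewrite leeBlDr// (le_trans (minval_le z' Xx))//.
  exact: H.
move=> z z' zr z'r; split; last exact: L.
have br : `|base - base| < rho by rewrite subrr normr0.
have [xm /minval_base mE] := argmins_nonempty.
have := L z base zr br; have := L base z br zr; rewrite mE.
(* The estimates in both directions against the finite value at [base] rule out both infinities. *)
by case: (minval z).
Qed.

(** [worst z] is a supremum of continuous functions of [x], hence lower semicontinuous. Were the
    infimum not attained, some [v] would give a gap near each [x], and compactness a uniform gap. *)
Lemma minimizer_exists z : minval z \is a fin_num ->
  exists2 x, X x & worst z x = minval z.
Proof.
move=> /fineK; set c := fine _ => cE.
apply: contrapT => nex.
suff [rho rho0 H] : exists2 rho : R, 0 < rho & forall x, X x ->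
    ((c + rho)%:E <= worst z x)%E.
  have : ((c + rho)%:E <= minval z)%E.
    by apply: le_ereal_inf_tmp => _ [x Xx <-]; exact: H.
  by rewrite -cE lee_fin gerDl leNgt rho0.
apply: compact_uniform => //.
- move=> rho rho' x le_rho; apply: le_trans.
  by rewrite lee_fin lerD2l.
- move=> x Xx.
  have : (c%:E < worst z x)%E.
    rewrite lt_neqAle cE minval_le// andbT; apply/eqP => xE.
    by apply: nex; exists x.
  move=> /ereal_sup_gt[_ [v vU <-]]; rewrite lte_fin => cv.
  pose g := (obj v x - c) / 2.
  have g0 : 0 < g by rewrite divr_gt0// subr_gt0.
  have [d d0 hd] := (continuous_norm_ltP _ _).1 (@continuous_obj v x) g g0.
  exists (Num.min d g) => [|y]; first by rewrite lt_min d0.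
  rewrite lt_min => /andP[/hd yd _].
  apply: (@le_trans _ _ (obj v y)%:E); last by apply: ereal_sup_ubound; exists v.
  rewrite lee_fin; have : Num.min d g <= g by rewrite ge_min lexx orbT.
  by move: yd; rewrite ltr_distlC /g => /andP[]; lra.
Qed.

(** A point that is not optimal at [base] has a positive gap there, which survives small changes of
    [x] and [z]. *)
Lemma non_minimizer xb : X xb -> ~ argmins xb ->
  exists2 rho : R, 0 < rho & forall x z, `|x - xb| < rho -> `|z - base| < rho ->
    X x -> worst z x <> minval z.
Proof.
move=> Xb nb; have [xm hm] := argmins_nonempty; have mE := minval_base hm.
have gap : obj ub xm < obj ub xb.
  rewrite ltNge; apply/negP => h; apply: nb; split=> // x Xx.
  exact: le_trans h (hm.2 x Xx).
have [rho rho0 [K K0 [HW HM]]] := minval_lipschitz.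
(* The gap is [4 * g]; the changes in [obj ub], [worst] and [minval] cost at most [g] each. *)
pose g := (obj ub xb - obj ub xm) / 4.
have g0 : 0 < g by rewrite divr_gt0// subr_gt0.
have [d d0 hd] := (continuous_norm_ltP _ _).1 (@continuous_obj ub xb) g g0.
pose N := ((\sum_(k < s) m k) + 1)%N.
have KN : 0 < (K + 1) * N.+1%:R by rewrite mulr_gt0 ?ltr0n// ltr_wpDl.
exists (Num.min (Num.min rho d) (g / ((K + 1) * N.+1%:R))) => [|x z].
  by rewrite !lt_min rho0 d0 divr_gt0.
rewrite !lt_min => /andP[/andP[_ /hd xd] _] /andP[/andP[zr _] zg] Xx wE.
have br : `|base - base| < rho by rewrite subrr normr0.
have := HW x z base Xx zr br; have [zf _] := HM z z zr zr.
have [_] := HM base z br zr.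
rewrite worst_base wE mE -(fineK zf) -!EFinD !lee_fin (norm2_distC base z).
have zK : K * norm2 (z - base) <= g.
  move: zg; rewrite ltr_pdivlMr// => zg.
  have h1 : norm2 (z - base) <= N.+1%:R * `|z - base|.
    by rewrite (le_trans (norm2_le_norm _))// ler_wpM2r// ler_nat leqnSn.
  have := norm2_ge0 (z - base); nra.
by move: xd; rewrite ltr_distlC /g in zK * => /andP[]; lra.
Qed.

(** * Local Lipschitz continuity and the bound on the modulus *)

Lemma minval_increment (L : R) :
  (forall xb sg d, argmins xb -> active_selection xb sg ->
    dot (slope xb sg) d <= L * norm2 d) ->
  forall e : R, 0 < e -> exists2 rho : R, 0 < rho &
    forall z z', `|z - base| < rho -> `|z' - base| < rho ->
      (minval z' <= minval z + ((L + e) * norm2 (z' - z))%:E)%E.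
Proof.
move=> hL e e0.
(* The minimality premise is contradictory near points outside [argmins], so only slopes at
   minimizers count. [X x] is repeated because the local statement must hold for all nearby points,
   in [X] or not. *)
suff [rho rho0 H] : exists2 rho : R, 0 < rho & forall x, X x ->
    forall z z', `|z - base| < rho -> `|z' - base| < rho -> X x ->
    worst z x = minval z ->
    (worst z' x <= worst z x + ((L + e) * norm2 (z' - z))%:E)%E.
  have [rho1 rho10 [K K0 [_ HM]]] := minval_lipschitz.
  exists (Num.min rho rho1) => [|z z']; first by rewrite lt_min rho0.
  rewrite !lt_min => /andP[zr zr1] /andP[z'r z'r1].
  have [x Xx xE] := minimizer_exists (HM z z zr1 zr1).1.
  by rewrite (le_trans (minval_le z' Xx))// -xE H.
apply: compact_uniform => //.
  move=> rho rho' x le_rho H z z' zr z'r.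
  by apply: H; exact: lt_le_trans le_rho.
move=> xb Xb; have [hb|nb] := pselect (argmins xb); last first.
  have [rho rho0 H] := non_minimizer Xb nb.
  by exists rho => // x xr z z' zr _ Xx /(H x z xr zr Xx).
have [rho rho0 H] := worst_increment xb e0.
exists rho => // x xr z z' zr z'r _ _.
rewrite mulrDl; apply: H => // sg sgA.
exact: hL.
Qed.

Lemma loc_lip_at_minval : loc_lip_at minval base.
Proof.
have [rho rho0 [K K0 [_ HM]]] := minval_lipschitz.
exists K; split=> //; exists (rho / 2); split; first by rewrite divr_gt0.
have ball z : norm2 (z - base) <= rho / 2 -> `|z - base| < rho.
  move=> zr; rewrite (le_lt_trans (norm_le_norm2 _))// (le_lt_trans zr)//.
  by rewrite ltr_pdivrMr// ltr_pMr// ltr1n.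
move=> z z' /ball zr /ball z'r.
have [zf L1] := HM z z' zr z'r; have [z'f L2] := HM z' z z'r zr.
split=> //; move: L1 L2; rewrite (norm2_distC z') -{1 2}(fineK zf) -{1 2}(fineK z'f).
by rewrite -!EFinD !lee_fin ler_norml => L1 L2; apply/andP; split; lra.
Qed.

Definition lip_bound : \bar R :=
  ereal_sup [set (\sum_(k < s) \sum_(i < r k | active xb i)
               ereal_sup [set (Num.sqrt (norm2 (gradf i xb) ^+ 2
                                 + dot (gradf i xb) w ^+ 2))%:E
                         | w in [set w | (nrm w <= 1)%R]])%E
            | xb in argmins].

(** Real-valued form of the sum in [lip_bound], with [dual_arg] as the point of the unit ball. *)
Definition lip_term xb : R := \sum_(k < s) \sum_(i < r k | active xb i)
  Num.sqrt (norm2 (gradf i xb) ^+ 2 + dual i xb ^+ 2).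

Lemma lip_term_le xb : argmins xb -> ((lip_term xb)%:E <= lip_bound)%E.
Proof.
move=> hb; apply: le_trans (ereal_sup_ubound _); last by exists xb => //; reflexivity.
rewrite -sumEFin; apply: lee_sum => k _.
rewrite -sumEFin; apply: lee_sum => i _.
apply: ereal_sup_ubound; exists (dual_arg (@nrm k) (gradf i xb)) => //=.
exact: (dual_argP _ (nrmP k)).1.
Qed.

(** In each block the selected piece is one summand of [lip_term]; the rest is Cauchy-Schwarz in the
    plane for (|g|, |c|) and (|d|, |t|). *)
Lemma slope_le_lip_term xb sg z : active_selection xb sg ->
  dot (slope xb sg) z <= lip_term xb * norm2 z.
Proof.
move=> /forallP sgA; rewrite dot_slope /lip_term mulr_suml; apply: ler_sum => k _.
rewrite (bigD1 (sg k).1)//= mulrDl; apply: ler_wpDr.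
  rewrite mulr_ge0 ?norm2_ge0// sumr_ge0// => i _; exact: sqrtr_ge0.
set g := gradf _ _; set c := dual _ _; set d := submxrow _ _; set t := rsubmx _ _ _.
have h : ((-1) ^+ (sg k).2 * c * t) <= `|c| * `|t|.
  by rewrite (le_trans (ler_norm _))// -mulrA !normrM normrX normrN1 expr1n mul1r.
apply: (le_trans (lerD (CauchySchwarz_dot g d) h)).
have hz := sqr_norm2_block z k; rewrite -/d -/t in hz.
rewrite -ler_sqr ?nnegrE ?addr_ge0 ?mulr_ge0 ?norm2_ge0 ?sqrtr_ge0//.
rewrite exprMn sqr_sqrtr ?addr_ge0 ?sqr_ge0//.
apply: (@le_trans _ _ ((norm2 g ^+ 2 + c ^+ 2) * (norm2 d ^+ 2 + t ^+ 2))); last first.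
  by rewrite ler_wpM2l// addr_ge0 ?sqr_ge0.
rewrite -(real_normK (num_real c)) -(real_normK (num_real t)).
(* Lagrange's identity in dimension two. *)
rewrite -subr_ge0 (_ : _ - _ = (norm2 g * `|t| - `|c| * norm2 d) ^+ 2) ?sqr_ge0//.
by ring.
Qed.

Lemma lip_mod_minval_le : (lip_mod minval base <= lip_bound)%E.
Proof.
have [xm hm] := argmins_nonempty.
(* The value [+oo] is trivial, and [-oo] contradicts the real lower bound at a minimizer. *)
have := lip_term_le hm; case E : lip_bound => [L| |]; rewrite ?leey//.
rewrite -E => _; apply/lee_addgt0Pr => e e0.
have [rho rho0 H] : exists2 rho : R, 0 < rho & forall z z',
    `|z - base| < rho -> `|z' - base| < rho ->
      (minval z' <= minval z + ((L + e) * norm2 (z' - z))%:E)%E.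
  apply: minval_increment => // xb sg d hb sgA.
  rewrite (le_trans (slope_le_lip_term _ sgA))// ler_wpM2r ?norm2_ge0//.
  by rewrite -lee_fin -E lip_term_le.
have [rho1 rho10 [K K0 [_ HM]]] := minval_lipschitz.
pose eps := Num.min rho rho1.
apply: ge_ereal_inf.
exists (ereal_sup [set q | exists z z', [/\ z != z', norm2 (z - base) < eps,
    norm2 (z' - base) < eps &
    q = (`|minval z - minval z'| * ((norm2 (z - z'))^-1)%:E)%E]]).
  by exists eps => //=; rewrite lt_min rho0.
have ball y : norm2 (y - base) < eps -> `|y - base| < rho /\ `|y - base| < rho1.
  by move=> /(le_lt_trans (norm_le_norm2 _)); rewrite lt_min => /andP[].
apply: ge_ereal_sup => _ [z [z' [zz' /ball[zr zr1] /ball[z'r z'r1] ->]]].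
have [zf _] := HM z z zr1 zr1; have [z'f _] := HM z' z' z'r1 z'r1.
have := H z' z z'r zr; have := H z z' zr z'r.
have zz0 : 0 < norm2 (z - z').
  by rewrite lt_neqAle norm2_ge0 eq_sym norm2_eq0 subr_eq0 zz'.
rewrite E (norm2_distC z') -(fineK zf) -(fineK z'f) -!EFinD !lee_fin => h1 h2.
rewrite ler_pdivrMr// ler_norml; apply/andP; split; lra.
Qed.

(** The largest |<g, w>| on the Euclidean ball is |g|, attained at g / |g|; the root becomes the
    square root of 2 |g|^2. *)
Lemma lip_bound_euclidean : (forall k, @nrm k = @norm2 R (m k)) ->
  lip_bound = ((Num.sqrt 2)%:E * ereal_sup [set (\sum_(k < s)
      \sum_(i < r k | active xb i) norm2 (gradf i xb))%:E | xb in argmins])%E.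
Proof.
move=> nrmE; rewrite -ereal_sup_pZl ?sqrtr_gt0// image_comp.
congr ereal_sup; apply: eq_imagel => xb _ /=.
rewrite -EFinM mulr_sumr -sumEFin; apply: eq_bigr => k _.
rewrite mulr_sumr -sumEFin; apply: eq_bigr => i _.
set g := gradf i xb; have g0 := norm2_ge0 g.
have sq2 : Num.sqrt 2 * norm2 g = Num.sqrt (norm2 g ^+ 2 + norm2 g ^+ 2).
  rewrite (_ : _ + _ = 2 * norm2 g ^+ 2); last by ring.
  by rewrite sqrtrM// sqrtr_sqr ger0_norm.
apply/le_anti/andP; split.
  apply: ge_ereal_sup => _ [w /= w1 <-]; rewrite lee_fin sq2 ler_wsqrtr//.
  rewrite lerD2l -real_normK ?num_real// ler_sqr ?nnegrE//.
  by rewrite (le_trans (ler_norm_dot _ _))// ler_piMr// -nrmE.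
(* For [g = 0] the convention that the inverse of 0 is 0 gives [w = 0], which also works. *)
apply: ereal_sup_ubound; exists ((norm2 g)^-1 *: g).
  rewrite /= nrmE norm2Z ger0_norm ?invr_ge0//.
  by have [->|gn0] := eqVneq (norm2 g) 0; rewrite ?mulr0// mulVf.
rewrite sq2 dotZr -sqr_norm2; congr (Num.sqrt (_ + _ ^+ 2))%:E.
have [->|gn0] := eqVneq (norm2 g) 0; first by rewrite expr0n mulr0.
by rewrite expr2 mulKf.
Qed.

(** * From convex combinations of slopes to multipliers *)

Definition active_type xb : finType := {sg : selection | active_selection xb sg}.

Lemma active_type_inhabited xb : active_type xb.
Proof.
pose ik k : 'I_(r k) :=
  sval (cid (fmax_attained (fun j => f j (submxrow ub k) xb) (r0 k))).
pose sg : selection := [ffun k => (ik k, false)].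
exists sg; apply/forallP => k; rewrite ffunE /active /ik /=.
by case: (cid _) => i /= ->.
Qed.

(** [y k i] is the total weight of the selections using piece [i] in block [k], and [q k i] the same
    total with signs. As |q| <= y, scaling [dual_arg] by q / y stays in the unit ball. *)
Lemma hull_multipliers xb v :
  in_hull (fun t : active_type xb => slope xb (val t)) v ->
  exists (w : forall k : 'I_s, 'I_(r k) -> 'rV[R]_(m k))
         (y : forall k : 'I_s, 'I_(r k) -> R),
  [/\ forall k (i : 'I_(r k)), active xb i -> nrm (w k i) <= 1 /\ 0 <= y k i,
      forall k, \sum_(i < r k | active xb i) y k i = 1,
      forall k, submxrow (lsubmx v) k = \sum_(i < r k | active xb i) y k i *: gradf i xb
    & rsubmx v 0 0 = \sum_(k < s) \sum_(i < r k | active xb i)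
                        y k i * dot (gradf i xb) (w k i)].
Proof.
move=> [l [l0 l1 ->]].
pose y k (i : 'I_(r k)) := \sum_(t : active_type xb | (val t k).1 == i) l t.
pose q k (i : 'I_(r k)) :=
  \sum_(t : active_type xb | (val t k).1 == i) l t * (-1) ^+ (val t k).2.
have y0 k i : 0 <= y k i by apply: sumr_ge0.
have qy k i : `|q k i| <= y k i.
  rewrite (le_trans (ler_norm_sum _ _ _))//; apply: ler_sum => t _.
  by rewrite normrM normrX normrN1 expr1n mulr1 ger0_norm.
have act k (t : active_type xb) : active xb (val t k).1.
  by move: (valP t) => /forallP.
exists (fun k i => (q k i / y k i) *: dual_arg (@nrm k) (gradf i xb)), y; split.
- move=> k i _; split=> //; case: (nrmP k) => _ -> _.
  have [d1 _] := dual_argP (gradf i xb) (nrmP k).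
  rewrite mulr_ile1 ?is_norm_ge0// normrM normfV (ger0_norm (y0 k i)).
  have [->|yn0] := eqVneq (y k i) 0; first by rewrite invr0 mulr0.
  by rewrite ler_pdivrMr ?mul1r// lt_neqAle eq_sym yn0 y0.
- move=> k; rewrite -l1 [RHS](partition_big
    (fun t : active_type xb => (val t k).1) (@active k xb)) //.
- move=> k; rewrite linear_sum submxrow_sum /=.
  rewrite (partition_big (fun t : active_type xb => (val t k).1) (@active k xb)) /=;
    last by move=> t _; exact: act.
  apply: eq_bigr => i _; rewrite scaler_suml; apply: eq_bigr => t /eqP <-.
  rewrite linearZ /= row_mxKl -[in RHS](mxrowK (fun k => gradf (val t k).1 xb) k).
  by apply/rowP => j; rewrite !mxE.
- rewrite [rsubmx _]linear_sum summxE /=.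
  rewrite (eq_bigr (fun t : active_type xb => \sum_(k < s)
      l t * ((-1) ^+ (val t k).2 * dual (val t k).1 xb))); last first.
    by move=> t _; rewrite linearZ /= row_mxKr !mxE mulr_sumr.
  rewrite exchange_big /=; apply: eq_bigr => k _.
  rewrite (partition_big (fun t : active_type xb => (val t k).1) (@active k xb)) /=;
    last by move=> t _; exact: act.
  apply: eq_bigr => i _.
  rewrite (eq_bigr (fun t : active_type xb =>
      l t * (-1) ^+ (val t k).2 * dual i xb)); last by move=> t /eqP <-; rewrite mulrA.
  rewrite -mulr_suml dotZr mulrA; congr (_ * _); rewrite -/(q k i).
  (* If [y k i] is 0 then so is [q k i], so the quotient by 0 does no harm. *)
  have [yE|yn0] := eqVneq (y k i) 0; last by rewrite mulrC divfK.
  have := qy k i; rewrite yE normr_le0 => /eqP ->.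
  by rewrite mul0r.
Qed.

(** * Subgradients lie in the hull of the slopes at some minimizer *)

(** Along [z + t *: d] the regular subgradient makes [minval] grow by at least about t <v, d>, while
    a minimizer near [xb] limits the growth to about t (<v, d> - |d|^2). *)
Lemma regular_subgradient_excludes xb v : ~ in_hull (fun t : active_type xb =>
    slope xb (val t)) v ->
  exists2 rho : R, 0 < rho & forall x, `|x - xb| < rho -> forall z v',
    `|z - base| < rho -> `|v' - v| < rho -> reg_subgrad minval z v' ->
    X x -> worst z x <> minval z.
Proof.
move=> /(hull_separation (active_type_inhabited xb))[d dn0 hd].
have d0 : 0 < norm2 d by rewrite lt_neqAle norm2_ge0 eq_sym norm2_eq0 dn0.
(* Three errors occur: the regular subgradient inequality, [worst_increment], and replacing [v'] by
   [v]. Each costs at most t |d|^2 / 4, in total less than t |d|^2. *)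
have e0 : 0 < norm2 d / 4 by rewrite divr_gt0.
have [rho rho0 H] := worst_increment xb e0.
pose D := \sum_i `|d 0 i|.
have D0 : 0 <= D by apply: sumr_ge0.
have D1 : 0 < D + 1 by rewrite ltr_wpDl.
exists (Num.min rho (norm2 d ^+ 2 / 4 / (D + 1))).
  by rewrite lt_min rho0 !divr_gt0// exprn_gt0.
move=> x; rewrite lt_min => /andP[xr _] z v'.
rewrite !lt_min => /andP[zr _] /andP[_ v'r] [zf sub] Xx xE.
have [del [del0 {}sub]] := sub _ e0.
(* Small enough that the step stays within [del] of [z] and within [rho] of [base]; the factor 2
   makes both bounds strict. *)
pose t := Num.min del (rho - `|z - base|) / (2 * norm2 d).
have t0 : 0 < t by rewrite divr_gt0 ?mulr_gt0// lt_min del0 subr_gt0.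
have td : t * norm2 d < Num.min del (rho - `|z - base|).
  rewrite /t invfM mulrA divfK ?gt_eqF// ltr_pdivrMr// ltr_pMr ?ltr1n//.
  by rewrite lt_min del0 subr_gt0.
move: td; rewrite lt_min => /andP[td1 td2].
have zE : z + t *: d - z = t *: d by rewrite addrAC subrr add0r.
have n2 : norm2 (t *: d) = t * norm2 d by rewrite norm2Z gtr0_norm.
have h1 := sub (z + t *: d); rewrite zE n2 dotZr in h1.
have z'r : `|z + t *: d - base| < rho.
  rewrite addrAC (le_lt_trans (ler_normD _ _))// -ltrBrDl (le_lt_trans _ td2)//.
  by rewrite -n2 norm_le_norm2.
have h2 := H x z (z + t *: d) (t * (dot v d - norm2 d ^+ 2)) xr zr z'r.
rewrite zE n2 in h2.
have hB sg : active_selection xb sg ->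
    dot (slope xb sg) (t *: d) <= t * (dot v d - norm2 d ^+ 2).
  move=> sgA; rewrite dotZr ler_wpM2l ?(ltW t0)//.
  by have := hd (exist _ sg sgA); rewrite /= lerBrDr.
have h3 := le_trans (h1 td1) (le_trans (minval_le _ Xx) (h2 hB)).
move: h3; rewrite xE -{2}(fineK zf) -EFinD lee_fin.
have h4 : `|dot (v' - v) d| <= norm2 d ^+ 2 / 4.
  rewrite (le_trans (ler_norm_dot_sum _ _))// -/D.
  move: v'r; rewrite ltr_pdivlMr// => v'r; have := normr_ge0 (v' - v); nra.
move: h4; rewrite dotDl dotNl ler_norml => /andP[h4 _].
have : 0 < t * norm2 d ^+ 2 by rewrite mulr_gt0// exprn_gt0.
nra.
Qed.

Lemma subgrad_in_hull v : subgrad minval base v ->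
  exists2 xb, argmins xb & in_hull (fun t : active_type xb => slope xb (val t)) v.
Proof.
move=> [_ [zs [vs [zs_cvg _ reg vs_cvg]]]].
apply: contrapT => nex.
have [rho rho0 H] : exists2 rho : R, 0 < rho & forall x, X x ->
    forall z v', `|z - base| < rho -> `|v' - v| < rho -> reg_subgrad minval z v' ->
    X x -> worst z x <> minval z.
  apply: compact_uniform => //.
    move=> rho rho' x le_rho H z v' zr v'r.
    by apply: H; exact: lt_le_trans le_rho.
  move=> xb Xb; have [hb|nb] := pselect (argmins xb); last first.
    have [rho rho0 H] := non_minimizer Xb nb.
    by exists rho => // x xr z v' zr _ _ Xx; exact: H.
  by apply: regular_subgradient_excludes => hv; apply: nex; exists xb.
have [k [zr vr]] : exists k, `|zs k - base| < rho /\ `|vs k - v| < rho.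
  have Hz : \forall k \near \oo, `|zs k - base| < rho.
    exact: cvgr_distC_lt zs_cvg _ rho0.
  have Hv : \forall k \near \oo, `|vs k - v| < rho.
    exact: cvgr_distC_lt vs_cvg _ rho0.
  by have [k []] := filter_ex (filterI Hz Hv); exists k.
(* A regular subgradient at [zs k] presupposes a finite value there, so a minimizer exists, against
   the exclusion over all of [X]. *)
have [x Xx xE] := minimizer_exists (reg k).1.
exact: (H x Xx (zs k) (vs k) zr vr (reg k) Xx).
Qed.

End RobustMinValue.

Unset Implicit Arguments.

(** * Assembly of the Lipschitz and subgradient statements *)

Theorem theorem1 (R : realType) (n s : nat) (m r : 'I_s -> nat)
  (f0 : 'rV[R]_n -> R) (X : set 'rV[R]_n)
  (f : forall k : 'I_s, 'I_(r k) -> 'rV[R]_(m k) -> 'rV[R]_n -> R)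
  (nrm : forall k : 'I_s, 'rV[R]_(m k) -> R)
  (ub : 'rV[R]_(\sum_(k < s) m k)) :
  loc_lip (fun x => (f0 x)%:E) ->
  X !=set0 -> compact X ->
  (forall k, (0 < r k)%N) ->
  (forall k i, C1 (fun z : 'rV[R]_(m k) * 'rV[R]_n => f k i z.1 z.2)) ->
  (forall k, is_norm (nrm k)) ->
  let F (v : 'rV[R]_(\sum_(k < s) m k)) (x : 'rV[R]_n) : R :=
    f0 x + \sum_(k < s) fmax (fun i => f k i (submxrow v k) x) in
  let U (u : 'rV[R]_(\sum_(k < s) m k)) (delta : R) :=
    [set v : 'rV[R]_(\sum_(k < s) m k) |
      forall k, nrm k (submxrow v k - submxrow u k) <= `|delta|] in
  let p (z : 'rV[R]_((\sum_(k < s) m k) + 1)) : \bar R :=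
    ereal_inf [set ereal_sup [set (F v x)%:E | v in U (lsubmx z) (rsubmx z 0 0)]
              | x in X] in
  let M := [set xb | X xb /\ forall x, X x -> F ub xb <= F ub x] in
  let I (k : 'I_s) (x : 'rV[R]_n) (i : 'I_(r k)) : bool :=
    f k i (submxrow ub k) x == fmax (fun j => f k j (submxrow ub k) x) in
  let g (k : 'I_s) (i : 'I_(r k)) (x : 'rV[R]_n) : 'rV[R]_(m k) :=
    grad1 (fun z : 'rV[R]_(m k) * 'rV[R]_n => f k i z.1 z.2) (submxrow ub k) x in
  let zb : 'rV[R]_((\sum_(k < s) m k) + 1) := row_mx ub 0 in
  let bound (nrm' : forall k : 'I_s, 'rV[R]_(m k) -> R) : \bar R :=
    ereal_sup [set (\sum_(k < s) \sum_(i < r k | I k xb i)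
                 ereal_sup [set (Num.sqrt (norm2 (g k i xb) ^+ 2
                                   + dot (g k i xb) w ^+ 2))%:E
                           | w in [set w | (nrm' k w <= 1)%R]])%E
              | xb in M] in
  [/\ loc_lip_at p zb,
      (lip_mod p zb <= bound nrm)%E,
      ((forall k, nrm k = @norm2 R (m k)) ->
         bound nrm = ((Num.sqrt 2)%:E *
           ereal_sup [set (\sum_(k < s) \sum_(i < r k | I k xb i)
                             norm2 (g k i xb))%:E | xb in M])%E)
    & forall v : 'rV[R]_((\sum_(k < s) m k) + 1), subgrad p zb v ->
      exists2 xb, M xb &
      exists (w : forall k : 'I_s, 'I_(r k) -> 'rV[R]_(m k))
             (y : forall k : 'I_s, 'I_(r k) -> R),
      [/\ forall k (i : 'I_(r k)), I k xb i -> nrm k (w k i) <= 1 /\ 0 <= y k i,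
          forall k, \sum_(i < r k | I k xb i) y k i = 1,
          forall k, submxrow (lsubmx v) k = \sum_(i < r k | I k xb i) y k i *: g k i xb
        & rsubmx v 0 0 = \sum_(k < s) \sum_(i < r k | I k xb i)
                            y k i * dot (g k i xb) (w k i)]].
Proof.
move=> f0lip X0 cX r0 fC1 nrmP F U p M I g zb bound; split.
(* The local definitions are convertible to those of the section: [p] to [minval], [M] to [argmins],
   [bound nrm] to [lip_bound]. *)
- exact (@loc_lip_at_minval R n s m r f0 X f nrm ub f0lip X0 cX r0 fC1 nrmP).
- exact (@lip_mod_minval_le R n s m r f0 X f nrm ub f0lip X0 cX r0 fC1 nrmP).
- exact (@lip_bound_euclidean R n s m r f0 X f nrm ub).
- move=> v hv.
  have [xb hb hull] :=
    @subgrad_in_hull R n s m r f0 X f nrm ub f0lip X0 cX r0 fC1 nrmP v hv.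
  by exists xb => //; exact (@hull_multipliers R n s m r f nrm ub nrmP xb v hull).
Qed.
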